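(* Suppose that for all finite, simple graphs $G$ and $H$ and every leaf $\ell$ of $G$, $$\gamma(G\square H)\ge\gamma(G)\gamma(H)\ \Longrightarrow\ \gamma((G-\ell)\square H)\ge\gamma(G-\ell)\gamma(H).$$ Then the following hold. (1) If $G$ is a finite, simple, connected, bipartite graph with $|V(G)|>1$ and bipartition $V(G)=A_G\cup B_G$, $H$ is a finite, simple graph, and $G$ admits a minimum dominating set $D$ and a bipartition class $X\in\{A_G,B_G\}$ satisfying $|D\cap X|/|X|>\delta(H)$, then $\gamma(G\square H)\ge\gamma(G)\gamma(H)$. (2) In particular, if $G$ and $H$ are finite, simple, connected, bipartite graphs with $|V(G)|>1$, $|V(H)|>1$ and $\delta(G)\ne\delta(H)$, then $\gamma(G\square H)\ge\gamma(G)\gamma(H)$.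
   Context: $\gamma(G)$ is the domination number of $G$, i.e. the minimum cardinality of a dominating set of $G$ (a set $D\subseteq V(G)$ such that every vertex is in $D$ or adjacent to a vertex of $D$). A minimum dominating set is a dominating set of cardinality $\gamma(G)$. $G\square H$ is the Cartesian product of the graphs $G$ and $H$. A leaf is a vertex with exactly one neighbour, and $G-\ell$ is the graph obtained from $G$ by deleting the vertex $\ell$. The domination density is $\delta(G):=\gamma(G)/|V(G)|$ (so $\delta$ does not denote minimum degree). *)

(* Defs.v *)
From HB Require Import structures.
From mathcomp Require Import all_boot all_order all_algebra.
Set Implicit Arguments.
Unset Strict Implicit.
Unset Printing Implicit Defensive.

Import Order.TTheory GRing.Theory Num.Theory.

Record sgraph := SGraph {
  vertex :> finType;
  adj : rel vertex;
  adj_sym : symmetric adj;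
  adj_irrefl : irreflexive adj }.

Arguments adj {s} x y.

Definition cart_adj (G H : sgraph) : rel (G * H) :=
  fun p q => (p.1 == q.1) && adj p.2 q.2 || adj p.1 q.1 && (p.2 == q.2).

Fact cart_adj_sym (G H : sgraph) : symmetric (@cart_adj G H).
Proof.
move=> p q; rewrite /cart_adj (eq_sym p.1) (eq_sym p.2).
by rewrite (adj_sym p.1) (adj_sym p.2).
Qed.

Fact cart_adj_irrefl (G H : sgraph) : irreflexive (@cart_adj G H).
Proof. by move=> p; rewrite /cart_adj !adj_irrefl andbF. Qed.

Definition cart_prod (G H : sgraph) : sgraph :=
  SGraph (@cart_adj_sym G H) (@cart_adj_irrefl G H).

Definition del_adj (G : sgraph) (l : G) : rel {x : G | x != l} :=
  fun x y => adj (val x) (val y).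

Fact del_adj_sym (G : sgraph) (l : G) : symmetric (@del_adj G l).
Proof. by move=> x y; apply: adj_sym. Qed.

Fact del_adj_irrefl (G : sgraph) (l : G) : irreflexive (@del_adj G l).
Proof. by move=> x; apply: adj_irrefl. Qed.

Definition del_vertex (G : sgraph) (l : G) : sgraph :=
  SGraph (@del_adj_sym G l) (@del_adj_irrefl G l).

Definition leaf (G : sgraph) (x : G) : bool := #|[set y | adj x y]| == 1.

Definition dominating (G : sgraph) (D : {set G}) : bool :=
  [forall v, (v \in D) || [exists u in D, adj u v]].

(* The default argument [set: G] is always dominating, so this is a genuine
   minimum. *)
Definition gamma (G : sgraph) : nat :=
  #|[arg min_(D < [set: G] | dominating D) #|D|]|.

Definition min_dominating (G : sgraph) (D : {set G}) : bool :=
  dominating D && (#|D| == gamma G).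

(* For the graph with no vertices this is 0 / 0 = 0. *)
Definition density (G : sgraph) : rat := ((gamma G)%:R / #|G|%:R)%R.

Definition connected (G : sgraph) : Prop :=
  forall x y : G, connect adj x y.

Definition independent (G : sgraph) (A : {set G}) : Prop :=
  {in A &, forall x y, ~~ adj x y}.

Definition bipartition (G : sgraph) (A B : {set G}) : Prop :=
  [/\ A :|: B = [set: G], [disjoint A & B], independent A & independent B].

Definition bipartite (G : sgraph) : Prop :=
  exists A B : {set G}, bipartition A B.

(* Main.v *)
Require Import Defs.
From HB Require Import structures.
From mathcomp Require Import all_boot all_order all_algebra.

(** The leaf-removal hypothesis yields the inequality
    [gamma G * gamma H <= gamma (cart_prod G H)] for every pair of graphs, and
    both parts of the theorem are instances of it.

    Attach one pendant vertex to each vertex of [G].  For the resulting corona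
    the inequality holds outright ([corona_vizing]): its domination number is
    at most [#|G|], while in the product with [H] the pendant copy of [H] over
    each vertex [x] can only be dominated from the two copies of [H] over [x]
    and over its pendant.  These pairs of copies are disjoint, one for each
    [x], and each of them meets a dominating set in at least [gamma H]
    vertices.

    The pendants are then removed from the corona one at a time
    ([vizing_trim]).  Every one of them is still a leaf when its turn comes,
    because its only neighbour belongs to [G] and is never removed; hence the
    hypothesis carries the inequality along, down to [G] itself. *)

Definition vizing (G H : sgraph) : Prop :=
  gamma G * gamma H <= gamma (cart_prod G H).

Lemma dominatingP (G : sgraph) (D : {set G}) :
  reflect (forall v, v \in D \/ exists2 u, u \in D & adj u v) (dominating D).
Proof.
apply: (iffP forallP) => domD v; have := domD v.
  by case/orP=> [|/exists_inP]; [left | right].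
by case=> [-> // | /exists_inP ->]; rewrite orbT.
Qed.

Lemma gamma_le (G : sgraph) (D : {set G}) : dominating D -> gamma G <= #|D|.
Proof.
rewrite /gamma; case: arg_minnP => [|M _ minM domD]; last exact: minM.
by apply/dominatingP => v; left; rewrite inE.
Qed.

Lemma gamma_attained (G : sgraph) :
  exists2 D : {set G}, dominating D & #|D| = gamma G.
Proof.
rewrite /gamma; case: arg_minnP => [|M domM _]; last by exists M.
by apply/dominatingP => v; left; rewrite inE.
Qed.

(** The image of a dominating set under a surjective homomorphism is
    dominating. *)
Lemma gamma_surj_hom (G K : sgraph) (f : G -> K) :
    (forall y, exists x, f x = y) ->
    (forall x y, adj x y -> adj (f x) (f y)) ->
  gamma K <= gamma G.
Proof.
move=> f_surj f_hom; have [D /dominatingP domD <-] := gamma_attained G.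
apply: leq_trans (leq_imset_card f D); apply: gamma_le.
apply/dominatingP => y; have [x <-] := f_surj y.
have [xD | [u uD ux]] := domD x; [left | right]; first exact: imset_f.
by exists (f u); [apply: imset_f | apply: f_hom].
Qed.

Lemma vizing_iso (G K H : sgraph) (f : G -> K) :
    bijective f -> (forall x y, adj (f x) (f y) = adj x y) ->
  vizing K H -> vizing G H.
Proof.
move=> [g fK gK] f_adj vizK.
have leGK : gamma G <= gamma K.
  apply: (@gamma_surj_hom _ _ g) => [x | x y xy]; first by exists (f x).
  by rewrite -f_adj !gK.
apply: leq_trans (leq_mul leGK (leqnn _)) (leq_trans vizK _).
apply: (@gamma_surj_hom (cart_prod G H) (cart_prod K H)
  (fun p => (f p.1, p.2))) => [[y h] | p q].
  by exists (g y, h); rewrite /= gK.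
by rewrite /= /cart_adj /= f_adj (can_eq fK).
Qed.

(** Deleting from [K] a vertex outside the copy [f(G)] of [G] does not affect
    the unique neighbours of the other outside vertices, since these neighbours
    lie in the copy; so the same situation recurs in a smaller graph, until
    [f] is an isomorphism. *)
Lemma vizing_trim (H : sgraph) :
    (forall (K : sgraph) (l : K),
       leaf l -> vizing K H -> vizing (del_vertex l) H) ->
  forall (G K : sgraph) (f : G -> K),
    injective f -> (forall x y, adj (f x) (f y) = adj x y) ->
    (forall l, l \notin codom f -> exists x, forall y, adj l y = (y == f x)) ->
  vizing K H -> vizing G H.
Proof.
move=> del_leaf G K; have [n] := ubnP #|K|.
elim: n K => // n IHn K ltKn f f_inj f_adj f_pend vizK.
have [/forallP f_onto | /forallPn[l l_out]] :=
    boolP [forall y, y \in codom f].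
  apply: (@vizing_iso _ _ _ f) vizK => //.
  by exists (fun y => iinv (f_onto y)) => x; rewrite ?f_iinv // iinv_f.
have l_leaf : leaf l.
  have [x lx] := f_pend l l_out.
  apply/cards1P; exists (f x); apply/setP => y; by rewrite !inE lx.
have fNl x : f x != l by apply: contraNneq l_out => <-; apply: codom_f.
pose g x : del_vertex l := exist _ (f x) (fNl x).
apply: (IHn (del_vertex l) _ g) (del_leaf K l l_leaf vizK).
- have K_gt0 : 0 < #|K| by apply/card_gt0P; exists l.
  by rewrite card_sig cardC1 prednK.
- by move=> x y [/f_inj].
- exact: f_adj.
move=> m m_out; have [|x mx] := f_pend (val m).
  apply: contra m_out => /codomP[x mfx].
  by apply/codomP; exists x; apply: val_inj.
by exists x => y; rewrite -val_eqE; apply: mx.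
Qed.

(** In the corona of [G], [(x, false)] is the vertex [x] of [G] and
    [(x, true)] is the pendant vertex attached to it. *)
Definition corona_adj (G : sgraph) : rel (G * bool) :=
  fun p q => if p.2 == q.2 then ~~ p.2 && adj p.1 q.1 else p.1 == q.1.

Lemma corona_adj_sym (G : sgraph) : symmetric (@corona_adj G).
Proof.
by case=> x [] [y []]; rewrite /corona_adj //= 1?eq_sym 1?adj_sym.
Qed.

Lemma corona_adj_irrefl (G : sgraph) : irreflexive (@corona_adj G).
Proof. by move=> p; rewrite /corona_adj eqxx adj_irrefl andbF. Qed.

Definition corona (G : sgraph) : sgraph :=
  SGraph (@corona_adj_sym G) (@corona_adj_irrefl G).

Lemma gamma_corona (G : sgraph) : gamma (corona G) <= #|G|.
Proof.
pose D : {set corona G} := [set (x, false) | x : G].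
apply: leq_trans (leq_imset_card (fun x : G => (x, false)) _).
apply: (@gamma_le (corona G) D).
apply/dominatingP => -[x []]; [right | left]; last exact: imset_f.
by exists (x, false); [apply: imset_f | rewrite /= /corona_adj /=].
Qed.

(** The vertex [((x, true), h)] is dominated only from vertices over [x] or
    over its pendant, so the part of a dominating set lying over these two
    projects onto a dominating set of [H]. *)
Lemma corona_fibre (G H : sgraph) (D : {set cart_prod (corona G) H}) (x : G) :
  dominating D -> gamma H <= #|[set p in D | p.1.1 == x]|.
Proof.
move=> /dominatingP domD.
apply: leq_trans (leq_imset_card snd _); apply: gamma_le.
apply/dominatingP => h; have [inD | [[[y b] k] inD]] := domD ((x, true), h).
  by left; apply/imsetP; exists ((x, true), h); rewrite ?inE ?inD /=.
rewrite /= /cart_adj /= => /orP[/andP[/eqP[yx _] kh] | /andP[yx /eqP kh]].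
  right; exists k => //; apply/imsetP.
  by exists ((y, b), k); rewrite // inE inD /= yx.
left; apply/imsetP; exists ((y, b), k); rewrite // inE inD /=.
by move: yx; rewrite /corona_adj /=; case: (b).
Qed.

Lemma corona_vizing (G H : sgraph) : vizing (corona G) H.
Proof.
rewrite /vizing; apply: leq_trans (leq_mul (gamma_corona G) (leqnn _)) _.
have [D domD <-] := gamma_attained (cart_prod (corona G) H).
rewrite -sum1_card (partition_big (fun p => p.1.1) xpredT) //= -sum_nat_const.
apply: leq_sum => x _; rewrite sum1dep_card; exact: corona_fibre.
Qed.

Lemma leaf_removal_vizing :
    (forall (G H : sgraph) (l : G),
       leaf l -> vizing G H -> vizing (del_vertex l) H) ->
  forall G H : sgraph, vizing G H.
Proof.
move=> del_leaf G H.
apply: (@vizing_trim H _ G (corona G) (fun x => (x, false))) => //.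
- by move=> K l; apply: del_leaf.
- by move=> x y [].
- case=> x [] out; last by rewrite codom_f in out.
  exists x => -[y []]; rewrite /= /corona_adj -pair_eqE /= ?andbF //.
  by rewrite andbT eq_sym.
exact: corona_vizing.
Qed.

Theorem mainTheorem7 :
  (forall (G H : sgraph) (l : G), leaf l ->
     gamma G * gamma H <= gamma (cart_prod G H) ->
     gamma (del_vertex l) * gamma H <= gamma (cart_prod (del_vertex l) H)) ->
  (forall (G H : sgraph) (A B : {set G}),
     connected G -> 1 < #|G| -> bipartition A B ->
     (exists (D X : {set G}),
        [/\ min_dominating D, X = A \/ X = B &
            (density H < #|D :&: X|%:R / #|X|%:R)%R]) ->
     gamma G * gamma H <= gamma (cart_prod G H)) /\
  (forall G H : sgraph,
     connected G -> bipartite G -> 1 < #|G| ->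
     connected H -> bipartite H -> 1 < #|H| ->
     density G <> density H ->
     gamma G * gamma H <= gamma (cart_prod G H)).
Proof.
move=> /leaf_removal_vizing viz.
by split=> [G H A B _ _ _ _ | G H _ _ _ _ _ _ _]; apply: viz.
Qed.
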